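(* Let $G=(V,E)$ be an undirected $\beta$-expander with $n$ vertices and maximum degree $\Delta$. Then the randomized query complexity of local search on $G$ is $\Omega\left(\frac{\beta\sqrt{n}}{\Delta\log^2 n}\right)$. (The $\Omega$ is uniform: there are absolute constants $c>0$ and $n_0$ such that the bound $c\,\beta\sqrt n/(\Delta\log^2 n)$ holds for every such $G$ with $n\ge n_0$.)
   Context: Local search: $G=(V,E)$ is a finite connected undirected graph known to the algorithm, and $f:V\to\mathbb{R}$ is an unknown function accessible through an oracle; a query names a vertex $v$ and receives $f(v)$. A vertex $v$ is a local minimum if $f(v)\le f(u)$ for all $\{u,v\}\in E$. The task is to output a local minimum. Randomized query complexity: the minimum over randomized algorithms that, for every input $f$, output a correct solution with probability at least $9/10$, of the worst-case (over inputs) expected number of queries, the expectation being over the algorithm's coin tosses. Expander: for $S\subseteq V$ let $E(S,V\setminus S)=\{(u,v)\in E\mid u\in S,\ v\notin S\}$. The graph is a $\beta$-expander (with $\beta>0$) if $|E(S,V\setminus S)|\ge\beta\cdot|S|$ for all $S\subseteq V$ with $0<|S|\le n/2$. *)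

(* Defs.v *)
(* MathComp / MathComp-Analysis *)
From HB Require Import structures.
From mathcomp Require Import all_boot all_order all_algebra.
From mathcomp Require Import all_classical all_reals all_analysis.

Set Implicit Arguments.
Unset Strict Implicit.
Unset Printing Implicit Defensive.

Import Order.TTheory GRing.Theory Num.Theory.
Import numFieldNormedType.Exports.

Local Open Scope classical_set_scope.
Local Open Scope ring_scope.

Definition simple_graph (V : finType) (e : rel V) : Prop :=
  symmetric e /\ irreflexive e.

Definition connected_graph (V : finType) (e : rel V) : Prop :=
  forall x y : V, connect e x y.

Definition max_degree (V : finType) (e : rel V) : nat :=
  \max_(v : V) #|[set u | e v u]%SET|.

Definition edge_boundary (V : finType) (e : rel V) (S : {set V}) :
    {set V * V} :=
  [set p : V * V | [&& e p.1 p.2, p.1 \in S & p.2 \notin S]]%SET.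

Definition expander (R : realType) (V : finType) (e : rel V) (beta : R) :
    Prop :=
  0 < beta /\
  forall S : {set V}, (0 < #|S|)%N -> #|S|%:R <= #|V|%:R / 2 :> R ->
    beta * #|S|%:R <= #|edge_boundary e S|%:R.

Definition local_min (R : realType) (V : finType) (e : rel V) (f : V -> R)
    (v : V) : Prop :=
  forall u : V, e v u -> f v <= f u.

(* Deterministic query algorithms: an internal node names the vertex to query
   and branches on the real number returned by the oracle. *)
Inductive dtree (R : realType) (V : finType) : Type :=
| Output of V
| Query of V & (R -> dtree R V).

Fixpoint output (R : realType) (V : finType) (t : dtree R V) (f : V -> R) :
    V :=
  match t with
  | Output v => v
  | Query v k => output (k (f v)) f
  end.

Fixpoint nqueries (R : realType) (V : finType) (t : dtree R V) (f : V -> R) :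
    nat :=
  match t with
  | Output _ => 0%N
  | Query v k => (nqueries (k (f v)) f).+1
  end.

(* The coin tosses form an arbitrary probability space; each outcome selects a
   deterministic algorithm.  On a fixed input, the output and the number of
   queries have to be random variables. *)
Record ralgo (R : realType) (V : finType) := RAlgo {
  coin_display : measure_display;
  coins : measurableType coin_display;
  coin_law : probability coins R;
  run : coins -> dtree R V;
  measurable_output : forall (f : V -> R) (v : V),
    measurable [set w | output (run w) f = v];
  measurable_nqueries : forall f : V -> R,
    measurable_fun [set: coins] (fun w => nqueries (run w) f)
}.

Definition solves_local_search (R : realType) (V : finType) (e : rel V)
    (A : ralgo R V) : Prop :=
  forall f : V -> R,
    ((9 / 10)%:E <=
      coin_law A [set w | local_min e f (output (run w) f)])%E.

Definition expected_queries (R : realType) (V : finType) (A : ralgo R V)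
    (f : V -> R) : \bar R :=
  (\int[coin_law A]_w ((nqueries (run w) f)%:R : R)%:E)%E.

Definition worst_case_queries (R : realType) (V : finType) (A : ralgo R V) :
    \bar R :=
  ereal_sup [set expected_queries A f | f in [set: V -> R]].

Definition randomized_query_complexity (R : realType) (V : finType)
    (e : rel V) : \bar R :=
  ereal_inf [set q : \bar R | exists A : ralgo R V,
    solves_local_search e A /\ q = worst_case_queries A].

(* Main.v *)
(* Yao's principle with a hard distribution built from a lazy max-degree random
   walk: [f] decreases along the walk (by time of last visit) and equals the
   distance to the starting point off the walk, so the end of the walk is its
   only local minimum.  By Cheeger's argument the walk mixes in
   [l = O((Delta / beta)^2 log n)] steps.  Cut it into blocks of length [l] and
   reveal one more block for free after every query.  A query meets the part of
   the walk beyond the next block with probability at most [2 / n] per step of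
   the walk, so [T] queries on a walk of [T + 1] blocks succeed with probability
   [O((1 + T^2 l) / n)].  Hence [T] must be of order
   [sqrt (n / l) = Omega (beta sqrt n / (Delta sqrt (log n)))], which is even
   stronger than needed. *)
Require Import Defs.
From HB Require Import structures.
From mathcomp Require Import all_boot all_order all_algebra.
From mathcomp Require Import all_classical all_reals all_analysis.
From mathcomp Require Import measurable_realfun ring lra zify.

Import Order.TTheory GRing.Theory Num.Theory.
Import numFieldNormedType.Exports.

Local Open Scope classical_set_scope.
Local Open Scope ring_scope.

Set Implicit Arguments.
Unset Strict Implicit.
Unset Printing Implicit Defensive.

(** * Cheeger's argument: a Poincare inequality for expanders *)

(** Discrete coarea inequality, by induction on the support [S]: subtracting the least positive
    value of [h] on [S] lowers the two sides by that value times [beta * #|S|] and times the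
    boundary size of [S], which expansion compares. *)
Lemma expander_coarea (R : realType) (V : finType) (e : rel V) (beta : R)
    (h : V -> R) :
  expander e beta -> (forall v, 0 <= h v) ->
  #|[set v | 0 < h v]%SET|%:R <= #|V|%:R / 2 :> R ->
  beta * \sum_v h v <=
    \sum_(p : V * V | e p.1 p.2) Num.max 0 (h p.1 - h p.2).
Proof.
move=> [_ expE]; have [k] := ubnP #|[set v | 0 < h v]%SET|.
elim: k h => // k IHk h; rewrite ltnS => lek h0 hhalf.
set S := [set v | 0 < h v]%SET in lek hhalf.
have hS v : v \notin S -> h v = 0.
  by rewrite inE -leNgt => hv; apply/le_anti; rewrite hv h0.
have [S0|[v0 v0S]] := set_0Vmem S.
  rewrite big1 ?mulr0; first by apply: sumr_ge0 => p _; rewrite le_max lexx.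
  by move=> v _; apply: hS; rewrite S0 inE.
have [w wS minw] : {w | w \in S & forall v, v \in S -> h w <= h v}.
  by case: (arg_minP h v0S) => w wS minw; exists w.
have hw0 : 0 < h w by rewrite inE in wS.
pose h' v := h v - h w *+ (v \in S).
have h'0 v : 0 <= h' v.
  rewrite /h'; case: (boolP (v \in S)) => [vS|vS]; last by rewrite subr0.
  by rewrite subr_ge0 minw.
have subS : [set v | 0 < h' v]%SET \proper S.
  apply/properP; split; last first.
    by exists w => //; rewrite inE /h' wS subrr ltxx.
  apply/fintype.subsetP => v; rewrite !inE /h'.
  by case: (boolP (v \in S)) => [|_]; [rewrite inE|rewrite subr0].
have {IHk} := IHk h' _ h'0 _.
have cS := proper_card subS.
move=> /(_ (leq_trans cS lek)) /(_ (le_trans _ hhalf)).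
rewrite ler_nat (ltnW cS) => /(_ isT) IH.
have S_gt0 : (0 < #|S|)%N by apply/card_gt0P; exists v0.
have := expE S S_gt0 hhalf.
move=> /(ler_wpM2l (ltW hw0)) bS.
have -> : \sum_v h v = \sum_v h' v + h w * #|S|%:R.
  rewrite mulr_natr -sumr_const [X in _ + X]big_mkcond /= -big_split /=.
  by apply: eq_bigr => v _; rewrite /h'; case: ifP => _;
    rewrite ?subr0 ?addr0 ?subrK.
rewrite mulrDr; apply: le_trans (lerD IH _) _.
  by rewrite mulrCA; exact: bS.
have -> : h w * #|edge_boundary e S|%:R =
   \sum_(p : V * V | e p.1 p.2) h w *+ ((p.1 \in S) && (p.2 \notin S)).
  rewrite mulr_natr -sumr_const big_mkcond [RHS]big_mkcond /=.
  apply: eq_bigr => p _; rewrite inE.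
  by case: (e _ _) => //=; case: ifP.
rewrite -big_split /=; apply: ler_sum => p _; rewrite /h'.
case: (boolP (p.1 \in S)) => p1; case: (boolP (p.2 \in S)) => p2 /=;
  rewrite ?subr0 ?addr0 ?mulr0n ?mulr1n.
- by rewrite (_ : h p.1 - h w - (h p.2 - h w) = h p.1 - h p.2) //; ring.
- rewrite (hS _ p2) !subr0 !max_r ?h0 ?subr_ge0 ?minw // subrK //.
- rewrite (hS _ p1) !sub0r !max_l ?addr0 //.
  + by rewrite oppr_le0 h0.
  + by rewrite oppr_le0 subr_ge0 minw.
- by [].
Qed.

Lemma max_degree_ub (V : finType) (e : rel V) (v : V) :
  (#|[set u | e v u]%SET| <= max_degree e)%N.
Proof. exact: (leq_bigmax v). Qed.

Lemma sum_edges_fst (R : realType) (V : finType) (e : rel V) (g : V -> R) :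
  \sum_(p : V * V | e p.1 p.2) g p.1 =
  \sum_v #|[set u | e v u]%SET|%:R * g v.
Proof.
rewrite -(pair_big_dep xpredT e (fun u _ => g u)) /=.
apply: eq_bigr => v _; rewrite mulr_natl -sumr_const.
by apply: eq_bigl => u; rewrite inE.
Qed.

(** For symmetric [e] each edge is counted in both orientations. *)
Definition energy (R : realType) (V : finType) (e : rel V) (g : V -> R) : R :=
  \sum_(p : V * V | e p.1 p.2) (g p.1 - g p.2) ^+ 2.

Lemma sum_edges_sq_le (R : realType) (V : finType) (e : rel V) (g : V -> R) :
  symmetric e ->
  \sum_(p : V * V | e p.1 p.2) (g p.1 ^+ 2 + g p.2 ^+ 2) <=
    2 * (max_degree e)%:R * \sum_v g v ^+ 2.
Proof.
move=> syme; rewrite big_split /=.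
have -> : \sum_(p : V * V | e p.1 p.2) g p.2 ^+ 2 =
          \sum_(p : V * V | e p.1 p.2) g p.1 ^+ 2.
  have swapI : injective (fun p : V * V => (p.2, p.1)).
    by move=> [a b] [c d] [-> ->].
  by rewrite (reindex_inj swapI) /=; apply: eq_bigl => p; rewrite syme.
rewrite -mulr2n -mulrA mulr_natl ler_pMn2r //.
rewrite (sum_edges_fst e (fun v => g v ^+ 2)) mulr_sumr.
apply: ler_sum => v _; rewrite ler_wpM2r ?sqr_ge0 // ler_nat.
exact: max_degree_ub.
Qed.

(** Expansion of a single vertex; [1 < #|V|] makes a singleton at most half of the graph. *)
Lemma expander_le_max_degree (R : realType) (V : finType) (e : rel V)
    (beta : R) :
  expander e beta -> (1 < #|V|)%N -> beta <= (max_degree e)%:R.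
Proof.
move=> [beta0 expE] V1; have /card_gt0P[v _] := ltnW V1.
have := expE [set v]%SET; rewrite cards1 => /(_ isT); rewrite mulr1.
have n2 : 2 <= #|V|%:R :> R by rewrite ler_nat.
move=> /(_ _)/le_trans; apply; first lra.
rewrite ler_nat; apply: leq_trans (max_degree_ub e v).
have -> : edge_boundary e [set v]%SET =
    [set (v, u) | u in [set u | e v u && (u != v)]%SET]%SET.
  apply/setP => -[a b]; rewrite !inE /=; apply/idP/imsetP.
    by case/and3P=> eab /eqP av bv; exists b; rewrite ?inE -?av ?eab ?av.
  by case=> u; rewrite inE => /andP[evu uv] [-> ->]; rewrite evu eqxx.
rewrite card_imset; last by move=> a b [].
by apply: subset_leq_card; apply/fintype.subsetP => u; rewrite !inE => /andP[].
Qed.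

(** The coarea inequality is applied to [g ^+ 2], whose differences are then traded for the
    energy. *)
Lemma expander_poincare_half (R : realType) (V : finType) (e : rel V)
    (beta : R) (g : V -> R) :
  symmetric e -> expander e beta -> 0 < (max_degree e)%:R :> R ->
  (forall v, 0 <= g v) ->
  #|[set v | 0 < g v]%SET|%:R <= #|V|%:R / 2 :> R ->
  beta ^+ 2 * \sum_v g v ^+ 2 <= 4 * (max_degree e)%:R * energy e g.
Proof.
move=> syme expE; set D := _%:R => D0 g0 ghalf; have [beta0 _] := expE.
have := @expander_coarea _ _ _ _ (fun v => g v ^+ 2) expE
          (fun v => sqr_ge0 (g v)).
have -> : [set v | 0 < g v ^+ 2]%SET = [set v | 0 < g v]%SET.
  by apply/setP => v; rewrite !inE !lt_def sqrf_eq0 sqr_ge0 g0.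
move=> /(_ ghalf); set S := \sum_v _ => coarea.
(* This [t] makes the term [t * (2 * D * S)] below equal to half of [beta * S], so that the left
   side absorbs it. *)
pose t := beta / (4 * D).
have t0 : 0 < t by rewrite divr_gt0 // mulr_gt0.
have t20 : 0 < (2 * t)^-1 by rewrite invr_gt0 mulr_gt0.
(* AM-GM: a^2 - b^2 <= (a - b)^2 / (2t) + t (a^2 + b^2) *)
have : beta * S <= (2 * t)^-1 * energy e g + t * (2 * D * S).
  apply: le_trans coarea _.
  apply: le_trans (lerD (lexx _) (ler_wpM2l (ltW t0) (sum_edges_sq_le g syme))).
  rewrite /energy !mulr_sumr -big_split /=; apply: ler_sum => p _.
  have [a0 b0] := (g0 p.1, g0 p.2); move: (g p.1) (g p.2) a0 b0 => a b a0 b0.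
  rewrite ge_max; apply/andP; split.
    by apply: addr_ge0; apply: mulr_ge0;
      rewrite ?sqr_ge0 ?addr_ge0 ?sqr_ge0 // ltW.
  rewrite -subr_ge0.
  have -> : (2 * t)^-1 * (a - b) ^+ 2 + t * (a ^+ 2 + b ^+ 2) -
      (a ^+ 2 - b ^+ 2) =
      (2 * t)^-1 * (((a - b) - t * (a + b)) ^+ 2 + (t * (a - b)) ^+ 2).
    by field; rewrite gt_eqF.
  by rewrite mulr_ge0 ?addr_ge0 ?sqr_ge0 // ltW.
rewrite /t => key.
have -> : beta ^+ 2 * S = 2 * beta * (beta * S - beta / (4 * D) * (2 * D * S)).
  by field; rewrite gt_eqF.
have -> : 4 * D * energy e g =
    2 * beta * ((2 * (beta / (4 * D)))^-1 * energy e g).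
  by field; rewrite !gt_eqF.
by rewrite ler_pM2l ?mulr_gt0 // lerBlDr.
Qed.

(** Among the values with at most half of the vertices strictly below, take the largest; were more
    than half strictly above it, the least of those would still qualify. *)
Lemma median_exists (R : realType) (V : finType) (f : V -> R) :
  (0 < #|V|)%N -> exists m : R,
    (#|[set v | (f v < m)%R]%SET|.*2 <= #|V|)%N /\
    (#|[set v | (m < f v)%R]%SET|.*2 <= #|V|)%N.
Proof.
move=> /card_gt0P[v0 _].
pose Q v := (#|[set u | (f u < f v)%R]%SET|.*2 <= #|V|)%N.
have [w0 _ w0min] := @arg_minP _ _ _ v0 xpredT f isT.
have Qw0 : Q w0.
  rewrite /Q (_ : [set _ | _]%SET = finset.set0) ?cards0 //.
  by apply/setP => u; rewrite !inE ltNge w0min.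
have [w Qw wmax] := arg_maxP f Qw0.
exists (f w); split => //; rewrite leqNgt; apply/negP => big.
have [u0 u0w] : exists u, u \in [set v | (f w < f v)%R]%SET.
  by apply/card_gt0P; move: big; case: #|_|.
rewrite inE in u0w.
have [u uw umin] := @arg_minP _ _ _ u0 (fun v => f w < f v) f u0w.
have /wmax : Q u.
  have sub : [set v | (f v < f u)%R]%SET \subset ~: [set v | (f w < f v)%R]%SET.
    apply/fintype.subsetP => v; rewrite !inE => vu; apply/negP => wv.
    by have := umin v wv; rewrite leNgt vu.
  have := subset_leq_card sub; have := cardsC [set v | (f w < f v)%R]%SET.
  rewrite /Q; move: big; move: #|_| #|_| #|_| #|_|; lia.
by move=> /(lt_le_trans uw); rewrite ltxx.
Qed.

(** Cut [f] at a median into two nonnegative parts, each supported on at most half of the vertices,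
    and apply the previous inequality to both. *)
Lemma expander_poincare (R : realType) (V : finType) (e : rel V)
    (beta : R) (f : V -> R) :
  symmetric e -> expander e beta -> 0 < (max_degree e)%:R :> R ->
  \sum_v f v = 0 ->
  beta ^+ 2 * \sum_v f v ^+ 2 <= 4 * (max_degree e)%:R * energy e f.
Proof.
move=> syme expE; set D := _%:R => D0 f0.
have [V0|V0] := posnP #|V|.
  have noV (v : V) : False by have := card0_eq V0 v.
  rewrite big1 ?mulr0 => [|v _]; last by case: (noV v).
  by rewrite !mulr_ge0 ?(ltW D0) // sumr_ge0 // => p _; exact: sqr_ge0.
have [m [ltm gtm]] := median_exists f V0.
have half k : (k.*2 <= #|V|)%N -> k%:R <= #|V|%:R / 2 :> R.
  by rewrite -(@ler_nat R) -muln2 natrM => ?; lra.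
pose gp v := Num.max 0 (f v - m); pose gn v := Num.max 0 (m - f v).
have gpE : [set v | 0 < gp v]%SET = [set v | m < f v]%SET.
  by apply/setP => v; rewrite !inE lt_max ltxx subr_gt0.
have gnE : [set v | 0 < gn v]%SET = [set v | f v < m]%SET.
  by apply/setP => v; rewrite !inE lt_max ltxx subr_gt0.
have gp0 v : 0 <= gp v by rewrite le_max lexx.
have gn0 v : 0 <= gn v by rewrite le_max lexx.
have := expander_poincare_half syme expE D0 gp0.
rewrite gpE => /(_ (half _ gtm)) Hp.
have := expander_poincare_half syme expE D0 gn0.
rewrite gnE => /(_ (half _ ltm)) Hn.
have maxE (x : R) : (Num.max 0 x = x /\ 0 <= x) \/ (Num.max 0 x = 0 /\ x <= 0).
  by case: (lerP 0 x) => [|/ltW]; [left|right].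
(* An edge across the median only loses energy: [s ^ 2 + t ^ 2 <= (s + t) ^ 2] for nonnegative [s]
   and [t]. *)
have energyD : energy e gp + energy e gn <= energy e f.
  rewrite /energy -big_split /=; apply: ler_sum => p _; rewrite /gp /gn.
  move: (f p.1) (f p.2) => a b.
  case: (maxE (a - m)) => [[-> ?]|[-> ?]];
  case: (maxE (m - a)) => [[-> ?]|[-> ?]];
  case: (maxE (b - m)) => [[-> ?]|[-> ?]];
  case: (maxE (m - b)) => [[-> ?]|[-> ?]];
  nra.
(* As [f] has sum zero, recentring it at [m] cannot decrease the sum of squares. *)
have sumD : \sum_v f v ^+ 2 <= \sum_v gp v ^+ 2 + \sum_v gn v ^+ 2.
  apply: (@le_trans _ _ (\sum_v (f v ^+ 2 - 2 * m * f v + m ^+ 2))).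
    rewrite !big_split /= sumrN -mulr_sumr f0 mulr0 oppr0 addr0.
    by rewrite lerDl sumr_ge0 // => v _; exact: sqr_ge0.
  rewrite -big_split /=; apply: ler_sum => v _; rewrite /gp /gn.
  case: (maxE (f v - m)) => [[-> ?]|[-> ?]];
  case: (maxE (m - f v)) => [[-> ?]|[-> ?]]; nra.
apply: le_trans (ler_wpM2l (sqr_ge0 _) sumD) _; rewrite mulrDr.
apply: le_trans (lerD Hp Hn) _; rewrite -mulrDr ler_wpM2l // mulr_ge0 //.
Qed.

(** * The lazy max-degree walk and its mixing time *)

Definition average (R : realType) (V : finType) (P : V -> V -> R)
  (u : V -> R) (x : V) : R := \sum_y P x y * u y.

(** All edges get the same weight and the remaining mass stays put, so for symmetric [e] the kernel
    is symmetric even on irregular graphs and the uniform law is stationary. *)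
Definition lazy_walk (R : realType) (V : finType) (e : rel V) (x y : V) : R :=
  (x == y)%:R * (1 - #|[set u | e x u]%SET|%:R / (2 * (max_degree e)%:R)) +
  (e x y)%:R / (2 * (max_degree e)%:R).

Lemma sum_indicator (R : realType) (V : finType) (x : V) (f : V -> R) :
  \sum_y (x == y)%:R * f y = f x.
Proof.
rewrite (bigD1 x) //= eqxx mul1r big1 ?addr0 // => y.
by rewrite eq_sym => /negPf ->; rewrite mul0r.
Qed.

Lemma sum_adjacent (R : realType) (V : finType) (e : rel V) (x : V) :
  \sum_y (e x y)%:R = #|[set u | e x u]%SET|%:R :> R.
Proof.
rewrite -sumr_const [RHS]big_mkcond /=; apply: eq_bigr => y _.
by rewrite inE; case: (e x y).
Qed.

Section LazyWalk.
Variables (R : realType) (V : finType) (e : rel V).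
Hypothesis syme : symmetric e.
Hypothesis D0 : 0 < (max_degree e)%:R :> R.
Let D : R := (max_degree e)%:R.
Let P := @lazy_walk R V e.

Lemma degree_ratio_le1 x : #|[set u | e x u]%SET|%:R / D <= 1.
Proof. by rewrite ler_pdivrMr // mul1r ler_nat max_degree_ub. Qed.

Lemma lazy_walk_ge0 x y : 0 <= P x y.
Proof.
have := degree_ratio_le1 x; have := D0; rewrite -/D => D0' le1.
rewrite /P /lazy_walk -/D addr_ge0 // ?mulr_ge0 // ?invr_ge0
  ?mulr_ge0 ?(ltW D0) //.
rewrite subr_ge0 invfM mulrCA.
have : 0 <= #|[set u | e x u]%SET|%:R / D by rewrite divr_ge0 // ltW.
lra.
Qed.

Lemma lazy_walk_sum x : \sum_y P x y = 1.
Proof.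
rewrite /P /lazy_walk big_split /= sum_indicator -mulr_suml sum_adjacent.
by rewrite subrK.
Qed.

Lemma lazy_walk_sym x y : P x y = P y x.
Proof.
rewrite /P /lazy_walk syme eq_sym; congr (_ + _).
by have [->|_] := eqVneq y x; rewrite ?mul0r.
Qed.

Lemma lazy_walk_edge x y : ~~ ((x == y) || e x y) -> P x y = 0.
Proof.
rewrite negb_or /P /lazy_walk => /andP[/negPf -> /negPf ->].
by rewrite !mul0r addr0.
Qed.

(* A lazy chain is the midpoint of the identity and the stochastic kernel [Q]
   below; as [Q] is a contraction of l^2, [|P u|^2 <= <u, P u>]. *)
Lemma lazy_walk_norm_le (u : V -> R) :
  \sum_x average P u x ^+ 2 <= \sum_x u x * average P u x.
Proof.
pose Q x y :=
  (x == y)%:R * (1 - #|[set w | e x w]%SET|%:R / D) + (e x y)%:R / D.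
have Q0 x y : 0 <= Q x y.
  rewrite /Q addr_ge0 ?mulr_ge0 ?subr_ge0 ?degree_ratio_le1 // invr_ge0.
  exact: ltW.
have Q1 x : \sum_y Q x y = 1.
  by rewrite /Q big_split /= sum_indicator -mulr_suml sum_adjacent subrK.
have Qsym x y : Q x y = Q y x.
  rewrite /Q syme eq_sym; congr (_ + _).
  by have [->|_] := eqVneq y x; rewrite ?mul0r.
have PQ x : average P u x = (u x + average Q u x) / 2.
  rewrite /average -{1}(sum_indicator x u) -big_split /= mulr_suml.
  apply: eq_bigr => y _; rewrite /P /lazy_walk /Q -/D.
  by field; rewrite gt_eqF.
have jensen x : average Q u x ^+ 2 <= \sum_y Q x y * u y ^+ 2.
  rewrite -subr_ge0; set w := average Q u x.
  (* The gap in Jensen's inequality is the variance of [u] under the law [Q x]. *)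
  have -> : \sum_y Q x y * u y ^+ 2 - w ^+ 2 = \sum_y Q x y * (u y - w) ^+ 2.
    have -> : \sum_y Q x y * (u y - w) ^+ 2 =
        \sum_y (Q x y * u y ^+ 2 - 2 * w * (Q x y * u y) + w ^+ 2 * Q x y).
      by apply: eq_bigr => y _; ring.
    rewrite !big_split /= sumrN -!mulr_sumr Q1 -/(average Q u x) -/w.
    by ring.
  by apply: sumr_ge0 => y _; rewrite mulr_ge0 ?sqr_ge0.
have contr : \sum_x average Q u x ^+ 2 <= \sum_x u x ^+ 2.
  apply: le_trans (ler_sum _ (fun x _ => jensen x)) _.
  rewrite exchange_big /=; apply: ler_sum => y _.
  by under eq_bigr do rewrite Qsym; rewrite -mulr_suml Q1 mul1r.
rewrite -subr_ge0 -sumrB.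
have -> : \sum_x (u x * average P u x - average P u x ^+ 2) =
    (\sum_x u x ^+ 2 - \sum_x average Q u x ^+ 2) / 4.
  rewrite -sumrB mulr_suml; apply: eq_bigr => x _; rewrite PQ.
  by field.
by rewrite divr_ge0 // subr_ge0.
Qed.

(** Averaging [u x * (u x - u y)] over the two orientations of an edge gives [(u x - u y) ^ 2 / 2];
    the edge weight [1 / (2 * D)] then yields [4 * D]. *)
Lemma lazy_walk_dirichlet (u : V -> R) :
  \sum_x u x * average P u x = \sum_x u x ^+ 2 - energy e u / (4 * D).
Proof.
have PuE x : u x * average P u x =
    u x ^+ 2 - \sum_(y | e x y) u x * (u x - u y) / (2 * D).
  have -> : average P u x =
      u x - \sum_y (e x y)%:R / (2 * D) * (u x - u y).
    under [in RHS]eq_bigr do rewrite mulrBr.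
    rewrite sumrB -!mulr_suml sum_adjacent /average /P /lazy_walk -/D.
    under eq_bigr do rewrite mulrDl -mulrA.
    rewrite big_split /= (sum_indicator x (fun y => _ * u y)).
    by ring.
  rewrite mulrBr -expr2 mulr_sumr [in RHS]big_mkcond /=.
  congr (_ - _); apply: eq_bigr => y _; case: (e x y) => /=; first by ring.
  by rewrite mul0r mul0r mulr0.
under eq_bigr do rewrite PuE.
rewrite sumrB; congr (_ - _).
rewrite (pair_big_dep xpredT e (fun x y => u x * (u x - u y) / (2 * D))) /=.
have swapI : injective (fun p : V * V => (p.2, p.1)).
  by move=> [a b] [c d] [-> ->].
have swapE : \sum_(p | e p.1 p.2) u p.1 * (u p.1 - u p.2) / (2 * D) =
    \sum_(p | e p.1 p.2) u p.2 * (u p.2 - u p.1) / (2 * D).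
  by rewrite (reindex_inj swapI) /=; apply: eq_bigl => p; rewrite syme.
apply: (@mulIf _ 2) => //; rewrite mulr_natr mulr2n {1}swapE -big_split /=.
rewrite /energy !mulr_suml; apply: eq_bigr => p _.
by field; rewrite gt_eqF.
Qed.

Lemma average_sum (u : V -> R) : \sum_x average P u x = \sum_x u x.
Proof.
rewrite exchange_big /=; apply: eq_bigr => y _.
under eq_bigr do rewrite lazy_walk_sym.
by rewrite -mulr_suml lazy_walk_sum mul1r.
Qed.

Lemma averageB_cst (u : V -> R) (c : R) x :
  average P (fun y => u y - c) x = average P u x - c.
Proof.
rewrite /average; under eq_bigr do rewrite mulrBr.
by rewrite sumrB -mulr_suml lazy_walk_sum mul1r.
Qed.

(** The Poincare inequality bounds the energy term of the Dirichlet identity below by a multiple of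
    the squared norm. *)
Lemma lazy_walk_contraction (beta : R) (u : V -> R) :
  expander e beta -> \sum_x u x = 0 ->
  \sum_x average P u x ^+ 2 <=
    (1 - beta ^+ 2 / (16 * D ^+ 2)) * \sum_x u x ^+ 2.
Proof.
move=> expE u0; apply: le_trans (lazy_walk_norm_le u) _.
rewrite lazy_walk_dirichlet mulrBl mul1r lerD2l lerN2.
have := expander_poincare syme expE D0 u0; rewrite -/D => poinc.
rewrite -subr_ge0.
have -> : energy e u / (4 * D) - beta ^+ 2 / (16 * D ^+ 2) * \sum_x u x ^+ 2 =
   (4 * D * energy e u - beta ^+ 2 * \sum_x u x ^+ 2) / (16 * D ^+ 2).
  by field; rewrite gt_eqF.
by rewrite divr_ge0 ?subr_ge0 // mulr_ge0 // sqr_ge0.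
Qed.

(** The iterate is the probability of going from [x] to [v] in [i] steps. Its deviation from uniform
    has sum zero over [x], so its squared norm contracts at each step, and this norm dominates every
    entry. *)
Lemma lazy_walk_mixing (beta : R) (i : nat) (x v : V) :
  expander e beta -> (1 < #|V|)%N ->
  (iter i (average P) (fun y => (y == v)%:R) x - #|V|%:R^-1) ^+ 2 <=
    (1 - beta ^+ 2 / (16 * D ^+ 2)) ^+ i.
Proof.
move=> expE V1; set n : R := #|V|%:R; set d := fun y => (y == v)%:R.
have n0 : 0 < n by rewrite ltr0n ltnW.
have V_sum : \sum_(y : V) n^-1 = 1.
  by rewrite sumr_const -mulr_natl divff // gt_eqF.
have d1 : \sum_y d y = 1.
  rewrite -(sum_indicator v (fun=> 1)).
  by apply: eq_bigr => y _; rewrite mulr1 eq_sym.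
have sum0 k : \sum_y (iter k (average P) d y - n^-1) = 0.
  rewrite sumrB V_sum; apply/eqP; rewrite subr_eq0; apply/eqP.
  by elim: k => //= k IHk; rewrite average_sum.
have beta0 : 0 < beta by case: expE.
have betaD := expander_le_max_degree expE V1.
have gap1 : 0 <= 1 - beta ^+ 2 / (16 * D ^+ 2).
  rewrite subr_ge0 ler_pdivrMr ?mulr_gt0 ?exprn_gt0 //.
  rewrite -/D in betaD; nra.
apply: (@le_trans _ _ (\sum_y (iter i (average P) d y - n^-1) ^+ 2)).
  by rewrite (bigD1 x) //= lerDl sumr_ge0 // => y _; exact: sqr_ge0.
elim: i => [|i IHi] /=; last first.
  under eq_bigr do rewrite -averageB_cst.
  apply: le_trans (lazy_walk_contraction expE (sum0 i)) _.
  by rewrite (exprS _ i) ler_wpM2l.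
(* The initial squared norm is [1 - 1 / n]. *)
rewrite expr0 -d1; have : 0 < n^-1 by rewrite invr_gt0.
have -> : \sum_y (d y - n^-1) ^+ 2 =
    \sum_y (d y - 2 * n^-1 * d y + n^-1 * n^-1).
  by apply: eq_bigr => y _; rewrite /d; case: eqP => _ /=; ring.
rewrite !big_split /= sumrN -!mulr_sumr d1 V_sum; lra.
Qed.

(** Here [32 = 2 * 16]: from time [l] on the squared deviation is at most
    [exp (- 2 ln n) = 1 / n ^ 2], hence the probability at most [1 / n + 1 / n]. *)
Lemma lazy_walk_mixed (beta : R) (l : nat) :
  expander e beta -> (1 < #|V|)%N ->
  32 * (D / beta) ^+ 2 * ln #|V|%:R <= l%:R ->
  forall i x v, (l <= i)%N ->
    iter i (average P) (fun y => (y == v)%:R) x <= 2 / #|V|%:R.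
Proof.
move=> expE V1 lbig i x v li; set n : R := #|V|%:R.
have beta0 : 0 < beta by case: expE.
have n0 : 0 < n by rewrite ltr0n ltnW.
have betaD := expander_le_max_degree expE V1; rewrite -/D in betaD.
set g := beta ^+ 2 / (16 * D ^+ 2).
have g0 : 0 < g by rewrite divr_gt0 ?mulr_gt0 ?exprn_gt0.
have gap1 : 0 <= 1 - g.
  rewrite subr_ge0 ler_pdivrMr ?mulr_gt0 ?exprn_gt0 //; nra.
have decay : (1 - g) ^+ i <= n^-1 ^+ 2.
  apply: (@le_trans _ _ (expR (- g) ^+ i)).
    by rewrite lerXn2r ?nnegrE ?expR_ge0 // expR_ge1Dx.
  have -> : n^-1 ^+ 2 = expR (- (2 * ln n)).
    by rewrite expRN expRM_natl lnK ?posrE // exprVn.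
  rewrite -expRM_natr ler_expR mulNr lerN2.
  have : g * (32 * (D / beta) ^+ 2 * ln n) <= g * i%:R.
    by rewrite ler_wpM2l ?(ltW g0) // (le_trans lbig) // ler_nat.
  apply: le_trans; rewrite le_eqVlt; apply/orP; left; apply/eqP; rewrite /g.
  by field; rewrite !gt_eqF.
have := le_trans (lazy_walk_mixing i x v expE V1) decay.
rewrite -/n; set a := iter _ _ _ _ => sq.
have : 0 < n^-1 by rewrite invr_gt0.
rewrite leNgt => z0; apply/negP => a2; nra.
Qed.

End LazyWalk.

(** * Functions planted along a walk and their only possible local minimum *)

(** The position of the last occurrence, counted from 1; it is 0 when [v] is absent. *)
Definition last_visit (V : eqType) (p : seq V) (v : V) : nat :=
  (size p - index v (rev p))%N.

(** Positions start at 1, so values are negative on the walk and nonnegative off it. *)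
Definition walk_fun (R : realType) (V : finType) (h : V -> nat) (p : seq V)
    (v : V) : R :=
  if v \in p then - (last_visit p v)%:R else (h v)%:R.

(** This allows a query to be answered from the revealed part of the walk when the rest avoids
    [v]. *)
Lemma walk_fun_cat (R : realType) (V : finType) (h : V -> nat) (p q : seq V)
    (v : V) :
  v \notin q -> walk_fun R h (p ++ q) v = walk_fun R h p v.
Proof.
move=> vq; rewrite /walk_fun mem_cat (negPf vq) orbF /last_visit.
rewrite rev_cat index_cat mem_rev (negPf vq) size_cat size_rev addnC.
by rewrite subnDl.
Qed.

Lemma last_visit_lt (V : eqType) (p q : seq V) (v u : V) :
  v \notin u :: q ->
  (last_visit (p ++ v :: u :: q) v < last_visit (p ++ v :: u :: q) u)%N.
Proof.
move=> vq; rewrite /last_visit -cat_rcons rev_cat !index_cat !mem_rev.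
rewrite (negPf vq) mem_head size_cat size_rcons rev_rcons /= eqxx addn0.
have : (index u (rev (u :: q)) < size (u :: q))%N.
  by rewrite -(size_rev (u :: q)) index_mem mem_rev mem_head.
by rewrite size_rev /=; lia.
Qed.

Lemma last_occurrence (V : eqType) (s : seq V) (v : V) :
  v \in s -> exists p r, v \notin r /\ s = p ++ v :: r.
Proof.
elim: s => // a s IHs; rewrite inE.
have [vs _|vs] := boolP (v \in s).
  by have [p [r [vr ->]]] := IHs vs; exists (a :: p), r.
by rewrite orbF => /eqP <-; exists [::], s.
Qed.

(** Off the walk, a neighbour with smaller [h] has a smaller value; on it, the vertex following the
    last visit to [v] has a later last visit. Only the end of the walk escapes both. *)
Lemma walk_fun_local_min (R : realType) (V : finType) (e : rel V)
    (h : V -> nat) (x : V) (q : seq V) (v : V) :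
  (forall v, v != x -> exists2 u, e v u & (h u < h v)%N) ->
  path (fun a b => (a == b) || e a b) x q ->
  local_min e (walk_fun R h (x :: q)) v -> v = last x q.
Proof.
move=> hP; rewrite /local_min => pq minv.
have fle u : walk_fun R h (x :: q) u <= (h u)%:R.
  by rewrite /walk_fun; case: ifP => // _;
    rewrite lerNl (le_trans (y := 0)) ?oppr_le0.
have [vq|vq] := boolP (v \in x :: q); last first.
  have /hP[u evu huv] : v != x by apply: contraNneq vq => ->; exact: mem_head.
  have := minv u evu; rewrite {1}/walk_fun (negPf vq) => /le_trans/(_ (fle u)).
  by rewrite ler_nat leqNgt huv.
have [p [r [vr pE]]] := last_occurrence vq.
case: r => [|u r] in vr pE.
  by have := congr1 (last x) pE; rewrite last_cat /= => ->.
(* The step after the last visit cannot be a lazy one, since [v] does not recur. *)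
have evu : e v u.
  have : path (fun a b => (a == b) || e a b) x (x :: q) by rewrite /= eqxx.
  rewrite pE cat_path /= => /and4P[_ _ /orP[/eqP vu|//] _].
  by rewrite vu mem_head in vr.
have := minv u evu; rewrite pE /walk_fun !mem_cat !inE !eqxx !orbT lerN2.
by rewrite ler_nat leqNgt last_visit_lt.
Qed.

(** [h] is the length of a shortest path to [x]; the second vertex of such a path is the neighbour
    sought. *)
Lemma connected_distance (V : finType) (e : rel V) (x : V) :
  connected_graph e ->
  exists h : V -> nat, forall v, v != x -> exists2 u, e v u & (h u < h v)%N.
Proof.
move=> conn.
have ex v : exists k,
    `[< exists p, [/\ path e v p, last v p = x & size p = k] >].
  have /connectP[p pp px] := conn v x.
  by exists (size p); apply/asboolP; exists p.
exists (fun v => ex_minn (ex v)) => v vx.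
case: (ex_minnP (ex v)) => k /asboolP[[|u p] [/= pp lp sp]] kmin.
  by rewrite lp eqxx in vx.
have [evu pp'] := andP pp; exists u => //.
case: (ex_minnP (ex u)) => j _ /(_ (size p)); rewrite -sp ltnS; apply.
by apply/asboolP; exists p.
Qed.

(** * Expectations over trajectories, and the success of few queries *)

Section WalkMean.
Variables (R : realType) (V : finType) (P : V -> V -> R).

(** For a stochastic [P], the expectation of [F] over the trajectory of [m] steps from [x]; the list
    passed to [F] omits the start. *)
Fixpoint walk_mean (m : nat) (x : V) (F : seq V -> R) : R :=
  if m is m'.+1 then \sum_y P x y * walk_mean m' y (fun q => F (y :: q))
  else F [::].

Lemma eq_walk_mean m x (F G : seq V -> R) :
  F =1 G -> walk_mean m x F = walk_mean m x G.
Proof.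
elim: m x F G => [|m IHm] x F G FG /=; first exact: FG.
by apply: eq_bigr => y _; congr (_ * _); apply: IHm => q.
Qed.

Lemma walk_meanD m x (F G : seq V -> R) :
  walk_mean m x (fun q => F q + G q) = walk_mean m x F + walk_mean m x G.
Proof.
elim: m x F G => //= m IHm x F G; rewrite -big_split /=.
by apply: eq_bigr => y _; rewrite IHm mulrDr.
Qed.

Lemma walk_mean0 m x : walk_mean m x (fun=> 0) = 0.
Proof.
by elim: m x => //= m IHm x; rewrite big1 // => y _; rewrite IHm mulr0.
Qed.

Lemma walk_mean_sum (I : Type) (r : seq I) m x (F : I -> seq V -> R) :
  walk_mean m x (fun q => \sum_(i <- r) F i q) =
  \sum_(i <- r) walk_mean m x (F i).
Proof.
elim: r => [|i r IHr].
  by under eq_walk_mean do rewrite big_nil; rewrite walk_mean0 big_nil.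
by under eq_walk_mean do rewrite big_cons; rewrite walk_meanD IHr big_cons.
Qed.

(** The Markov property at time [a]. *)
Lemma walk_mean_cat a b x (F : seq V -> R) :
  walk_mean (a + b) x F =
  walk_mean a x (fun q => walk_mean b (last x q) (fun r => F (q ++ r))).
Proof.
by elim: a x F => //= a IHa x F; apply: eq_bigr => y _; rewrite IHa.
Qed.

Lemma walk_mean_last m x (u : V -> R) :
  walk_mean m x (fun q => u (last x q)) = iter m (average P) u x.
Proof.
by elim: m x => //= m IHm x; apply: eq_bigr => y _; rewrite IHm.
Qed.

(* Lets the mean over walks be exchanged with the mean over the coins. *)
Lemma walk_mean_support m x :
  exists s : seq (R * seq V), forall F,
    walk_mean m x F = \sum_(z <- s) z.1 * F z.2.
Proof.
elim: m x => [|m IHm] x.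
  by exists [:: (1, [::])] => F; rewrite big_seq1 mul1r.
have [s sE] := choice IHm.
exists (flatten [seq [seq (P x y * z.1, y :: z.2) | z <- s y] | y <- enum V]).
move=> F /=; rewrite big_flatten /= big_map big_enum /=.
apply: eq_bigr => y _; rewrite big_map sE mulr_sumr.
by apply: eq_bigr => z _; rewrite mulrA.
Qed.

Hypothesis P0 : forall x y, 0 <= P x y.

(** Trajectories leaving [r] have weight zero, so facts about genuine walks in the graph can be used
    under the mean. *)
Lemma walk_mean_le (r : rel V) m x (F G : seq V -> R) :
  (forall a b, ~~ r a b -> P a b = 0) ->
  (forall q, path r x q -> F q <= G q) -> walk_mean m x F <= walk_mean m x G.
Proof.
move=> Pr; elim: m x F G => [|m IHm] x F G FG /=; first exact: FG.
apply: ler_sum => y _.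
have [rxy|/Pr->] := boolP (r x y); last by rewrite !mul0r.
by rewrite ler_wpM2l // IHm // => q pq; apply: FG; rewrite /= rxy.
Qed.

Lemma ler_walk_mean m x (F G : seq V -> R) :
  (forall q, F q <= G q) -> walk_mean m x F <= walk_mean m x G.
Proof. by move=> FG; apply: (@walk_mean_le (fun _ _ => true)). Qed.

Hypothesis P1 : forall x, \sum_y P x y = 1.

Lemma walk_mean_cst m x (c : R) : walk_mean m x (fun=> c) = c.
Proof.
elim: m x => //= m IHm x; under eq_bigr do rewrite IHm.
by rewrite -mulr_suml P1 mul1r.
Qed.

(** Union bound over the times 1 to [m]. *)
Lemma walk_mean_hit m x v :
  walk_mean m x (fun q => (v \in q)%:R) <=
  \sum_(i < m) iter i.+1 (average P) (fun y => (y == v)%:R) x.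
Proof.
elim: m x => [|m IHm] x /=; first by rewrite big_ord0.
rewrite big_ord_recl /= [X in _ + X](_ : _ = \sum_y P x y *
    \sum_(i < m) iter i.+1 (average P) (fun y => (y == v)%:R) y); last first.
  under [RHS]eq_bigr do rewrite mulr_sumr.
  by rewrite exchange_big.
rewrite -big_split /=; apply: ler_sum => y _; rewrite -mulrDr ler_wpM2l //.
apply: le_trans (_ : walk_mean m y (fun q => (y == v)%:R + (v \in q)%:R) <= _).
  apply: ler_walk_mean => q; rewrite inE eq_sym.
  by case: (y == v); case: (v \in q) => /=; rewrite -?natrD ler_nat.
by rewrite walk_meanD walk_mean_cst lerD2l IHm.
Qed.

(* After each query the whole next block of [l] steps of the walk is revealed
   for free.  Unless the queried vertex lies beyond that block, the answer is
   then known, and the rest of the walk stays independent of the history. *)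
Lemma query_bound (h : V -> nat) (l : nat) (eps : R) (x : V) :
  (forall i a v, (l <= i)%N ->
     iter i (average P) (fun y => (y == v)%:R) a <= eps) ->
  forall (T : nat) (t : dtree R V) (p : seq V),
    walk_mean (T.+1 * l) (last x p) (fun q =>
      let f := walk_fun R h (x :: p ++ q) in
      ((nqueries t f <= T)%N && (output t f == last x (p ++ q)))%:R) <=
    eps * (1 + T%:R ^+ 2 * l%:R).
Proof.
move=> mixed.
have eps0 : 0 <= eps.
  apply: le_trans (mixed l x x (leqnn l)); rewrite -walk_mean_last.
  by rewrite -(walk_mean0 l x); apply: ler_walk_mean => q.
(* Without further queries the output [w] is fixed while at least [l] steps are still hidden, so it
   is the end of the walk with probability at most [eps]. *)
have leaf w p T : walk_mean (T.+1 * l) (last x p) (fun q =>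
    (w == last x (p ++ q))%:R) <= eps * (1 + T%:R ^+ 2 * l%:R).
  apply: (@le_trans _ _ eps); last first.
    by rewrite ler_peMr // lerDl mulr_ge0 // exprn_ge0.
  under eq_walk_mean do rewrite last_cat eq_sym.
  rewrite (walk_mean_last _ _ (fun y => (y == w)%:R)).
  by apply: mixed; rewrite mulSn leq_addr.
elim=> [|T IHT] [w|v k] p /=; try exact: leaf.
  by rewrite walk_mean0 mulr_ge0 // addr_ge0 // mulr_ge0 // exprn_ge0.
rewrite mulSn walk_mean_cat; set b := (T.+1 * l)%N.
pose g q := walk_fun R h (x :: p ++ q).
(* Success of the remaining algorithm when the query is answered from the walk revealed up to the
   end of the block [q1]. *)
pose G q1 q2 : R := ((nqueries (k (g q1 v)) (g (q1 ++ q2)) <= T)%N &&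
   (output (k (g q1 v)) (g (q1 ++ q2)) == last x (p ++ q1 ++ q2)))%:R.
pose hit y : R :=
  \sum_(i < b) iter i.+1 (average P) (fun z => (z == v)%:R) y.
apply: le_trans (_ : walk_mean l (last x p) (fun q1 =>
    hit (last (last x p) q1) + eps * (1 + T%:R ^+ 2 * l%:R)) <= _).
  apply: ler_walk_mean => q1.
  apply: le_trans (_ : walk_mean b (last (last x p) q1) (fun q2 =>
    (v \in q2)%:R + G q1 q2) <= _).
    apply: ler_walk_mean => q2; rewrite ltnS -/(g (q1 ++ q2)).
    have [_|vq2] := boolP (v \in q2).
      rewrite -[leLHS]addr0 lerD // /G ?ler0n //.
      by rewrite lern1 leq_b1.
    by rewrite add0r /G /g catA -cat_cons walk_fun_cat.
  rewrite walk_meanD lerD ?walk_mean_hit //.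
  have := IHT (k (g q1 v)) (p ++ q1); rewrite last_cat.
  by rewrite /G /g /=; under eq_walk_mean do rewrite -catA.
rewrite walk_meanD walk_mean_cst (walk_mean_last _ _ hit).
(* Crossing the block first delays every hitting time by [l], so mixing applies to each of them. *)
have -> : iter l (average P) hit (last x p) =
    \sum_(i < b) iter (l + i.+1) (average P) (fun z => (z == v)%:R) (last x p).
  rewrite -walk_mean_last /hit walk_mean_sum; apply: eq_bigr => i _.
  by rewrite (walk_mean_last _ _ (iter i.+1 _ _)) -iterD.
apply: le_trans (_ : b%:R * eps + eps * (1 + T%:R ^+ 2 * l%:R) <= _).
  rewrite lerD2r; apply: le_trans (ler_sum _ (_ : forall i, _ -> _ <= eps)) _.
    by move=> i _; apply: mixed; rewrite leq_addr.
  by rewrite sumr_const card_ord mulr_natl.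
(* What remains is [(T + 1) * l + T ^ 2 * l <= (T + 1) ^ 2 * l]. *)
rewrite mulrC -mulrDr ler_wpM2l // /b natrM -natr1.
have : 0 <= T%:R * l%:R :> R by rewrite mulr_ge0.
lra.
Qed.

End WalkMean.

(** * Randomized algorithms: exchanging coins and random inputs *)

(** The exchange behind Yao's principle: a bound valid for each outcome of the coins is integrated
    over them. *)
Lemma weighted_events_le (d : measure_display) (T : measurableType d)
    (R : realType) (mu : probability T R) (I : Type) (s : seq I) (c : I -> R)
    (E : I -> set T) (C : R) :
  (forall i, measurable (E i)) ->
  (forall w, \sum_(i <- s) c i * \1_(E i) w <= C) ->
  \sum_(i <- s) c i * fine (mu (E i)) <= C.
Proof.
move=> mE leC.
have intE i : mu.-integrable setT (fun w => (c i)%:E * (\1_(E i) w)%:E)%E.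
  by apply: integrableZl => //; exact: integrable_indic.
have : (\int[mu]_w (\sum_(i <- s) (c i)%:E * (\1_(E i) w)%:E) <=
        \int[mu]_w C%:E)%E.
  apply: le_integral => //.
  - exact: integrable_sum.
  - exact: finite_measure_integrable_cst.
  - by move=> w _; under eq_bigr do rewrite -EFinM; rewrite sumEFin lee_fin.
rewrite integral_cst //= probability_setT mule1.
rewrite integral_sum //.
rewrite (eq_bigr (fun i => (c i * fine (mu (E i)))%:E)) => [|i _].
  by rewrite sumEFin lee_fin.
rewrite (integralZl measurableT (integrable_indic mu (mE i))).
by rewrite integral_indic // setIT EFinM fineK //; exact: fin_num_measure.
Qed.

Lemma measurable_few_queries (R : realType) (V : finType) (A : ralgo R V)
    (f : V -> R) (T : nat) :
  measurable [set w : coins A | (nqueries (run w) f <= T)%N].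
Proof.
rewrite -[X in measurable X]setTI.
by apply: (@measurable_nqueries _ _ A f measurableT [set n | (n <= T)%N]).
Qed.

Lemma many_queriesE (R : realType) (V : finType) (A : ralgo R V)
    (f : V -> R) (T : nat) :
  [set w : coins A | (T < nqueries (run w) f)%N] =
  ~` [set w | (nqueries (run w) f <= T)%N].
Proof. by apply/seteqP; split => w /=; rewrite ltnNge => /negP. Qed.

Lemma measurable_output_in (R : realType) (V : finType) (A : ralgo R V)
    (f : V -> R) (Q : V -> Prop) :
  measurable [set w : coins A | Q (output (run w) f)].
Proof.
rewrite (_ : [set _ | _] =
    \bigcup_(v in [set v | Q v]) [set w : coins A | output (run w) f = v]).
  by apply: fin_bigcup_measurable => [|v _]; [|exact: measurable_output].
by apply/seteqP; split=> [w Qw|w [v /= Qv ->]//]; exists (output (run w) f).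
Qed.

Lemma measurable_success (R : realType) (V : finType) (A : ralgo R V)
    (f : V -> R) (T : nat) (v : V) :
  measurable [set w : coins A |
    (nqueries (run w) f <= T)%N && (output (run w) f == v)].
Proof.
rewrite (_ : [set _ | _] = [set w | (nqueries (run w) f <= T)%N] `&`
                           [set w | output (run w) f = v]).
  apply: measurableI; first exact: measurable_few_queries.
  exact: measurable_output.
apply/seteqP; split => w /=; first by case/andP=> ? /eqP.
by case=> ? /eqP ?; exact/andP.
Qed.

(** Markov's inequality; exceeding [T] means making at least [T + 1] queries. *)
Lemma few_queries_prob (R : realType) (V : finType) (A : ralgo R V)
    (f : V -> R) (B : R) (T : nat) :
  (expected_queries A f <= B%:E)%E -> 10 * B <= T.+1%:R ->
  (coin_law A [set w | (T < nqueries (run w) f)%N] <= (1 / 10)%:E)%E.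
Proof.
move=> EB BT; set S := [set w | _].
have mS : measurable S.
  by rewrite /S many_queriesE; apply: measurableC;
    exact: measurable_few_queries.
have finS : coin_law A S \is a fin_num by exact: fin_num_measure.
have : (T.+1%:R%:E * coin_law A S <= B%:E)%E.
  apply: le_trans EB; rewrite /expected_queries.
  rewrite -[S]setIT -integral_indic // -ge0_integralZl //; last first.
    by apply/measurable_EFinP; exact: measurable_indic.
  apply: ge0_le_integral => //.
  - by apply: measurable_funeM; apply/measurable_EFinP; exact: measurable_indic.
  - apply/measurable_EFinP.
    apply: (measurableT_comp (f := fun n : nat => n%:R : R)) => //.
    exact: measurable_nqueries.
  - move=> w _; rewrite -EFinM lee_fin indicE.
    have [/set_mem wS|_] := boolP (w \in S); last by rewrite mulr0.
    by rewrite mulr1 ler_nat.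
rewrite -(fineK finS) -EFinM !lee_fin => TB.
have T1 : 1 <= T.+1%:R :> R by rewrite ler1n.
rewrite -(ler_pM2l (lt_le_trans ltr01 T1)); lra.
Qed.

(** [8 / 10 = 9 / 10 - 1 / 10]: the outcomes with more than [T] queries are discarded by a union
    bound. *)
Lemma success_prob (R : realType) (V : finType) (e : rel V) (A : ralgo R V)
    (f : V -> R) (B : R) (T : nat) (v : V) :
  solves_local_search e A -> (expected_queries A f <= B%:E)%E ->
  10 * B <= T.+1%:R -> (forall u, local_min e f u -> u = v) ->
  8 / 10 <= fine (coin_law A
    [set w | (nqueries (run w) f <= T)%N && (output (run w) f == v)]).
Proof.
move=> solveA EB BT uniq_min; set S := [set w | _].
have mQ := measurable_few_queries A f T.
have mS : measurable S by exact: measurable_success.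
have few := few_queries_prob EB BT; set L := [set w | _] in few.
have mL : measurable L.
  by rewrite /L many_queriesE; exact: measurableC.
have : ((9 / 10)%:E <= coin_law A S + coin_law A L)%E.
  apply: le_trans (solveA f) _; apply: le_trans (measureU2 _ mS mL).
  apply: le_measure; rewrite ?inE.
  - exact: (@measurable_output_in _ _ A f (local_min e f)).
  - exact: measurableU.
  move=> w /= /uniq_min /eqP outv.
  by case: (leqP (nqueries (run w) f) T) => nT; [left; apply/andP|right].
have finS : coin_law A S \is a fin_num by exact: fin_num_measure.
have finL : coin_law A L \is a fin_num by exact: fin_num_measure.
move: few; rewrite -(fineK finS) -(fineK finL) -EFinD !lee_fin; lra.
Qed.

(** The mean success over random walks is at least [8 / 10] because it is so on each walk; for fixed
    coins [query_bound] with [eps = 2 / n] limits the same mean from above. *)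
Lemma expander_success_le (R : realType) (V : finType) (e : rel V) (beta : R)
    (A : ralgo R V) (B : R) (T l : nat) :
  simple_graph e -> connected_graph e -> expander e beta -> (1 < #|V|)%N ->
  32 * ((max_degree e)%:R / beta) ^+ 2 * ln #|V|%:R <= l%:R ->
  solves_local_search e A ->
  (forall f, (expected_queries A f <= B%:E)%E) -> 10 * B <= T.+1%:R ->
  8 / 10 <= 2 / #|V|%:R * (1 + T%:R ^+ 2 * l%:R) :> R.
Proof.
move=> [syme _] conn expE V1 lbig solveA EB BT.
have beta0 : 0 < beta by case: expE.
have D0 : 0 < (max_degree e)%:R :> R.
  exact: lt_le_trans beta0 (expander_le_max_degree expE V1).
have /card_gt0P[x _] := ltnW V1.
have [h hP] := connected_distance x conn.
have mixed := lazy_walk_mixed syme D0 expE V1 lbig.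
pose P := @lazy_walk R V e.
have P0 : forall a b, 0 <= P a b := lazy_walk_ge0 D0.
have P1 : forall a, \sum_b P a b = 1 := @lazy_walk_sum R V e.
pose f q := walk_fun R h (x :: q).
pose E q := [set w : coins A |
  (nqueries (run w) (f q) <= T)%N && (output (run w) (f q) == last x q)].
have mE q : measurable (E q) by exact: measurable_success.
apply: le_trans (_ : walk_mean P (T.+1 * l) x
  (fun q => fine (coin_law A (E q))) <= _).
  rewrite -(walk_mean_cst P1 (T.+1 * l) x (8 / 10)).
  apply: (walk_mean_le P0 (r := fun a b => (a == b) || e a b)).
    exact: lazy_walk_edge.
  move=> q pq; apply: success_prob solveA (EB _) BT _ => v.
  exact: walk_fun_local_min.
have [s sE] := walk_mean_support P (T.+1 * l) x.
rewrite sE; apply: weighted_events_le => // w.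
have := @query_bound _ _ _ P0 P1 h l _ x mixed T (run w) [::].
rewrite sE; apply: le_trans; apply: ler_sum => z _.
rewrite indicE le_eqVlt; apply/orP; left; apply/eqP; congr (_ * _%:R).
by congr nat_of_bool; apply/idP/idP => [/set_mem|] //; exact: mem_set.
Qed.

(** * Choice of the number of queries, the block length and the constants *)

Theorem corollary2 (R : realType) :
  exists (c : R) (n0 : nat), 0 < c /\
    forall (V : finType) (e : rel V) (beta : R),
      simple_graph e -> connected_graph e -> expander e beta ->
      (n0 <= #|V|)%N ->
      ((c * (beta * Num.sqrt #|V|%:R /
             ((max_degree e)%:R * ln #|V|%:R ^+ 2)))%:E
        <= randomized_query_complexity R e)%E.
Proof.
(* The success bound becomes [2 / n + 66 / 100]; [n >= 20] keeps it below [8 / 10] and also gives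
   [ln n >= 1]. *)
exists (1 / 100), 20%N; split; first by rewrite divr_gt0.
move=> V e beta simplee conn expE n20.
apply: le_ereal_inf_tmp => _ [A [solveA ->]].
set B : R := 1 / 100 * _; rewrite leNgt; apply/negP => ltB.
have EB f : (expected_queries A f <= B%:E)%E.
  by apply: le_trans (ltW ltB); apply: ereal_sup_ubound; exists f.
have V1 : (1 < #|V|)%N by exact: leq_trans n20.
have beta0 : 0 < beta by case: expE.
have betaD := expander_le_max_degree expE V1.
have {n20} n20 : 20 <= #|V|%:R :> R by rewrite ler_nat.
set D : R := (max_degree e)%:R in betaD B ltB EB *.
set n : R := #|V|%:R in n20 B ltB EB *; set L := ln n in B ltB EB *.
have D0 : 0 < D by exact: lt_le_trans betaD.
have n0 : 0 < n by lra.
have L1 : 1 <= L.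
  rewrite -ler_expR /L lnK ?posrE //.
  (* Squaring this gives [exp 1 <= 4], which is below [n]. *)
  have half : expR (2^-1) <= 2 :> R.
    have := expR_ge1Dx (- (2^-1 : R)); rewrite expRN => le_inv.
    have : 2^-1 <= (expR (2^-1))^-1 :> R by lra.
    by rewrite lef_pV2 ?posrE ?expR_gt0.
  have -> : 1 = 2%:R * 2^-1 :> R by rewrite divff.
  rewrite expRM_natl; apply: (@le_trans _ _ (2 ^+ 2)); last lra.
  by rewrite lerXn2r ?nnegrE ?expR_ge0.
have B0 : 0 <= B.
  by rewrite mulr_ge0 // divr_ge0 ?mulr_ge0 ?exprn_ge0 ?sqrtr_ge0 ?ltW //; lra.
have /andP[TB BT] := truncn_itv (mulr_ge0 (ler0n R 10) B0).
set T := Num.truncn _ in TB BT.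
pose M : R := 32 * (D / beta) ^+ 2 * L.
have DB1 : 1 <= D / beta by rewrite ler_pdivlMr ?mul1r.
have DB2 : 1 <= (D / beta) ^+ 2 by rewrite exprn_ege1.
have M0 : 0 <= M.
  by rewrite /M mulr_ge0 ?(le_trans ler01 L1) // mulr_ge0 ?sqr_ge0.
have /andP[lM Ml] := truncn_itv M0; set l := Num.truncn M in lM Ml.
have := expander_success_le simplee conn expE V1 (ltW Ml) solveA EB (ltW BT).
apply/negP; rewrite -ltNge -/n.
(* The block length is [l.+1]; passing from 32 to 33 absorbs the rounding, as
   [(D / beta) ^ 2 * L >= 1]. *)
have lle : l.+1%:R <= 33 * (D / beta) ^+ 2 * L.
  rewrite -natr1; apply: le_trans (_ : M + 1 <= _); first by rewrite lerD2r.
  by have := mulr_ege1 DB2 L1; rewrite /M -!mulrA; lra.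
have T2 : T%:R ^+ 2 <= (10 * B) ^+ 2.
  by rewrite lerXn2r ?nnegrE ?ler0n // mulr_ge0.
have L0 : 0 < L by exact: lt_le_trans L1.
(* All dependence on [beta] and [D] cancels, leaving a factor [1 / L ^ 3] that is simply bounded by
   1. *)
have Tl : T%:R ^+ 2 * l.+1%:R <= 33 / 100 * n.
  apply: le_trans (ler_pM (sqr_ge0 _) (ler0n _ _) T2 lle) _.
  have -> : (10 * B) ^+ 2 * (33 * (D / beta) ^+ 2 * L) =
      33 / 100 * n * (L ^+ 3)^-1.
    rewrite /B -[n in RHS]sqr_sqrtr ?(ltW n0) //.
    by field; rewrite !gt_eqF.
  rewrite ler_piMr ?mulr_ge0 ?(ltW n0) //.
  by rewrite invf_le1 ?exprn_ege1 // exprn_gt0.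
apply: le_lt_trans (_ : 2 / n * (1 + 33 / 100 * n) < _).
  by rewrite ler_wpM2l ?lerD2l ?divr_ge0 // ltW.
have -> : 2 / n * (1 + 33 / 100 * n) = 2 / n + 66 / 100.
  by field; rewrite gt_eqF.
have : 2 / n <= 1 / 10 by rewrite ler_pdivrMr //; lra.
lra.
Qed.
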